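(* For every fixed $a<\frac12$, with high probability, for every integer $k$ with $n-n^a\le k\le n$, \[|\mathcal L_k\cap C_{\tau_{\mathrm{end}}}|=1.\]
   Context: Let $n\ge 1$ and $\mathcal B=\{0,1\}^n$ with the coordinatewise partial order; $\mathbf 0=(0,\dots,0)$, $\mathbf 1=(1,\dots,1)$, $|x|$ denotes the number of ones of $x$, and $\mathcal L_k=\{x\in\mathcal B:|x|=k\}$ is the $k$th level. A random decreasing walk from $\mathbf 1$ is a maximal chain $\mathbf 1=x_n>x_{n-1}>\dots>x_0=\mathbf 0$ with $x_i\in\mathcal L_i$, chosen uniformly among all $n!$ such chains (equivalently, each step turns a uniformly random remaining $1$ into $0$). The DLA process on $\mathcal B$: $C_0=\{\mathbf 0\}$; for $t\ge1$, let $\rho_t$ be a random decreasing walk from $\mathbf 1$, independent of everything before; let $v$ be the last vertex of the longest initial segment of $\rho_t$ that is disjoint from $C_{t-1}$, and set $C_t=C_{t-1}\cup\{v\}$. The process terminates at the first time $\tau_{\mathrm{end}}$ with $\mathbf 1\in C_{\tau_{\mathrm{end}}}$. A vertex is occupied at time $t$ if it lies in $C_t$. ''With high probability'' (w.h.p.) means with probability tending to $1$ as $n\to\infty$. *)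

(* Defs.v *)
From mathcomp Require Import all_boot all_fingroup.
From Stdlib Require Import Reals.

Set Implicit Arguments.
Unset Strict Implicit.
Unset Printing Implicit Defensive.

(* A vertex of B = {0,1}^n is identified with its set of 1-coordinates,
   a {set 'I_n}; the coordinatewise order is inclusion, |x| = #|x|,
   0 = set0, 1 = setT. *)

(* A maximal decreasing chain 1 = x_n > ... > x_0 = 0 is encoded by the
   permutation s of the coordinates giving the order in which the 1s are
   turned into 0s.  [walk_vertex s j] is the j-th vertex visited (j = 0..n),
   i.e. x_{n-j} = 1 minus {s 0, ..., s (j-1)}.  This is a bijection between
   {perm 'I_n} and the n! maximal chains, so the uniform measure on
   permutations is the uniform measure on chains. *)
Definition walk_vertex n (s : {perm 'I_n}) (j : nat) : {set 'I_n} :=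
  [set i | j <= (s^-1)%g i].

Definition first_hit n (C : {set {set 'I_n}}) (s : {perm 'I_n}) : nat :=
  find (fun j => walk_vertex s j \in C) (iota 0 n.+1).

Definition dla_step n (C : {set {set 'I_n}}) (s : {perm 'I_n}) : {set {set 'I_n}} :=
  C :|: [set walk_vertex s (first_hit C s).-1].

(* Expected value of f(C_{tau_end}) for the process started from cluster C,
   with fuel bounding the number of remaining steps.  The walk is uniform
   over the n! permutations.  Once 1 \in C the process has stopped. *)
Fixpoint dla_expect n (fuel : nat) (C : {set {set 'I_n}})
    (f : {set {set 'I_n}} -> R) {struct fuel} : R :=
  if setT \in C then f C else
  match fuel with
  | 0 => f C
  | m.+1 => Rdiv (\big[Rplus/R0]_(s : {perm 'I_n}) dla_expect m (dla_step C s) f)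
                 (INR (n`!))
  end.

(* Probability that the final cluster C_{tau_end} satisfies E.
   Each step before termination adds a new vertex, so the process ends
   after at most 2^n - 1 steps; fuel 2^n is therefore never exhausted. *)
Definition dla_prob n (E : pred {set {set 'I_n}}) : R :=
  dla_expect (2 ^ n)%N [set set0] (fun C => if E C then R1 else R0).

Definition top_levels_unique n (a : R) (C : {set {set 'I_n}}) : bool :=
  [forall k : 'I_n.+1,
     (if Rle_dec (INR n - Rpower (INR n) a)%R (INR k) then true else false)
       ==> (#|[set x in C | #|x| == val k]| == 1)].
Arguments top_levels_unique n a C : clear implicits.

(* Main.v *)
(** Index levels by their distance [j] to the top, and let [N_j] be the number of
occupied vertices at distance [j] and [b_j = 'C(n, j)]. A walk meets a given
vertex at distance [j] with probability [1 / b_j], so level [j] gains a vertex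
with probability at most [N_(j+1) / b_(j+1)], while the highest occupied level
[h] is met with probability exactly [N_h / b_h].

Once distance [j - 1] is occupied, the remaining time is about [b_(j-1)], so
level [j] gains only about [(b_(j-1) / b_(j+1)) N_(j+1)] more vertices. Before
that, the exact hitting probability shows that [N_j (N_j - 1) / 2] has, when
distance [j - 1] is first reached, expectation at most [b_j / b_(j+1)] times
that of [N_(j+1)]. With [eps] bounding the ratios [b_j / b_(j+1)] and
[N <= c + N (N - 1) / (2 c)], the final expectations [V_j] of [N_j] satisfy
[V_j <= c + (eps / c + O(eps^2)) V_(j+1)], up to geometrically weighted
contributions from further levels, for every [c >= 1].

Starting from the trivial bound [V_J <= b_J] with [J = L m], [m ~ n^a], the
choice [c = 1 / eps] gives [V_j = O(1 / eps)] for [j <= m + 2]; two more steps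
with [c = 1] give [V_j <= 1 + O(eps)] for [j <= m]. As every level ends up
occupied, the failure probability is at most the sum of [V_j - 1] over
[1 <= j <= m], which is [O(m eps) = O(m^2 / n)]. *)

From Stdlib Require Import Reals.
From mathcomp Require Import all_boot all_order all_fingroup all_algebra.
From mathcomp Require Import Rstruct ring lra zify.
Require Import Defs.

Set Implicit Arguments.
Unset Strict Implicit.
Unset Printing Implicit Defensive.

Import Order.TTheory GRing.Theory Num.Theory.
Local Open Scope ring_scope.

(** * Walk vertices and their uniform law on each level *)

Lemma walk_vertex_imset n (s : {perm 'I_n}) j :
  walk_vertex s j = s @: [set k : 'I_n | (j <= k)%N].
Proof.
apply/setP => i; rewrite inE; apply/idP/imsetP => [ji|[k]].
  by exists ((s^-1)%g i); rewrite ?inE // permKV.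
by rewrite inE => jk ->; rewrite permK.
Qed.

Lemma card_walk_vertex n (s : {perm 'I_n}) j : #|walk_vertex s j| = (n - j)%N.
Proof.
rewrite walk_vertex_imset card_imset; last exact: perm_inj.
rewrite -sum1_card; under eq_bigl => k do rewrite inE.
by rewrite -(big_geq_mkord _ _ predT (fun=> 1%N)) sum_nat_const_nat muln1.
Qed.

Lemma walk_vertex_mulg n (s t : {perm 'I_n}) j :
  walk_vertex (s * t) j = t @: walk_vertex s j.
Proof.
rewrite !walk_vertex_imset -imset_comp.
by apply: eq_imset => k /=; rewrite permM.
Qed.

Lemma walk_vertex0 n (s : {perm 'I_n}) : walk_vertex s 0 = setT.
Proof. by apply/setP => i; rewrite !inE. Qed.

Lemma walk_vertex_last n (s : {perm 'I_n}) : walk_vertex s n = set0.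
Proof. by apply/eqP; rewrite -cards_eq0 card_walk_vertex subnn. Qed.

(** List each set followed by its complement; matching the two lists position by position gives the
    permutation. *)
Lemma perm_set_transitive (T : finType) (x y : {set T}) :
  #|x| = #|y| -> exists t : {perm T}, t @: x = y.
Proof.
move=> cxy.
pose l (z : {set T}) := enum z ++ enum (~: z).
have lT z k : k \in l z by rewrite mem_cat !mem_enum inE; case: (k \in z).
have lU z : uniq (l z).
  rewrite cat_uniq !enum_uniq /= andbT; apply/hasPn => k.
  by rewrite !mem_enum inE.
have lS z : size (l z) = #|T| by rewrite size_cat -!cardE cardsC.
pose f k := nth k (l y) (index k (l x)).
have ilt k : (index k (l x) < size (l y))%N.
  by rewrite lS -(lS x) index_mem.
have finj : injective f.
  move=> k k'; rewrite /f (set_nth_default k') //.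
  move/eqP; rewrite nth_uniq // => /eqP e.
  by rewrite -(nth_index k (lT x k)) e nth_index.
exists (perm finj); apply/eqP; rewrite eqEcard card_imset ?cxy ?leqnn ?andbT;
  last exact: perm_inj.
apply/subsetP => _ /imsetP [k kx ->]; rewrite permE /f nth_cat index_cat.
have kxe : k \in enum x by rewrite mem_enum.
rewrite kxe -cardE -cxy cardE index_mem kxe.
by rewrite -mem_enum mem_nth // -cardE -cxy cardE index_mem.
Qed.

(* Indexed by the distance [j] to the top, i.e. the paper's level [n - j]. *)
Definition level_count n (C : {set {set 'I_n}}) (j : nat) : nat :=
  #|[set x in C | (#|x| + j == n)%N]|.

(** Relabelling coordinates by a permutation carrying [y] to [x] maps the walks through [y]
    bijectively to those through [x], so the [n!] walks split evenly over the ['C(n, j)] vertices at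
    distance [j]. *)
Lemma card_walk_through n (x : {set 'I_n}) j : (#|x| + j = n)%N ->
  (#|[set s : {perm 'I_n} | walk_vertex s j == x]| * 'C(n, j) = n`!)%N.
Proof.
move=> cx.
have cxE : #|x| = (n - j)%N by lia.
have jn : (j <= n)%N by lia.
pose A := [set y : {set 'I_n} | #|y| == (n - j)%N].
have cA : #|A| = 'C(n, j) by rewrite card_draws card_ord bin_sub.
rewrite -(card_Sn n) -cA -[RHS]sum1_card.
rewrite [RHS](partition_big (fun s => walk_vertex s j) (mem A)) /=; last first.
  by move=> s _; rewrite inE card_walk_vertex.
rewrite [RHS](eq_bigr (fun=> #|[set s : {perm 'I_n} | walk_vertex s j == x]|)).
  by rewrite sum_nat_const mulnC.
move=> y; rewrite inE => /eqP cy; rewrite sum1dep_card.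
have [t tx] : exists t : {perm 'I_n}, t @: y = x by apply: perm_set_transitive; rewrite cy.
rewrite -(card_imset _ (mulIg t)); apply: eq_card => s; rewrite !inE.
apply/imsetP/eqP => [[u]|sx].
  by rewrite inE /= => /eqP uy ->; rewrite walk_vertex_mulg uy.
exists (s * t^-1)%g; last by rewrite mulgKV.
rewrite inE /= walk_vertex_mulg sx -tx -imset_comp.
by apply/eqP; rewrite -[RHS]imset_id; apply: eq_imset => k /=; rewrite permK.
Qed.

(** A walk visits one vertex per level, so the walks through distinct vertices of [C] at distance
    [j] form disjoint classes of equal size. *)
Lemma card_walk_hit n (C : {set {set 'I_n}}) j : (j <= n)%N ->
  (#|[set s : {perm 'I_n} | walk_vertex s j \in C]| * 'C(n, j)
    = level_count C j * n`!)%N.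
Proof.
move=> jn; rewrite -sum1_card.
rewrite (partition_big (fun s => walk_vertex s j)
           (mem [set x in C | (#|x| + j == n)%N])) /=; last first.
  by move=> s; rewrite !inE card_walk_vertex subnK // eqxx andbT.
rewrite big_distrl /= -sum_nat_const; apply: eq_bigr => x.
rewrite inE => /andP [xC /eqP cx]; rewrite -(card_walk_through cx) sum1dep_card.
congr (_ * _)%N; apply: eq_card => s; rewrite !inE.
by case: eqP => [->|]; rewrite ?xC ?andbF.
Qed.

Lemma level_count_le n (C : {set {set 'I_n}}) j : (j <= n)%N ->
  (level_count C j <= 'C(n, j))%N.
Proof.
move=> jn; rewrite -bin_sub // -[X in 'C(X, _)]card_ord -card_draws.
apply/subset_leq_card/subsetP => x; rewrite !inE => /andP [_ /eqP cx].
by apply/eqP; rewrite -[X in (X - j)%N]cx addnK.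
Qed.

Lemma level_count_gt0 n (C : {set {set 'I_n}}) x j :
  x \in C -> (#|x| + j = n)%N -> (0 < level_count C j)%N.
Proof. by move=> xC cx; apply/card_gt0P; exists x; rewrite inE xC cx eqxx. Qed.

Lemma level_count_hit n (C : {set {set 'I_n}}) (s : {perm 'I_n}) j : (j <= n)%N ->
  walk_vertex s j \in C -> (0 < level_count C j)%N.
Proof. by move=> jn /level_count_gt0; apply; rewrite card_walk_vertex subnK. Qed.

Lemma level_count_top n (C : {set {set 'I_n}}) : (0 < level_count C 0)%N = (setT \in C).
Proof.
apply/idP/idP => [|TC]; last by apply: (level_count_gt0 TC); rewrite addn0 cardsT card_ord.
case/card_gt0P => x; rewrite inE addn0 => /andP [xC /eqP cx].
have -> : setT = x; last by [].
by apply/esym/eqP; rewrite eqEcard subsetT cardsT card_ord cx leqnn.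
Qed.

(** * The first hit and the effect of one step *)

Lemma first_hitP n (C : {set {set 'I_n}}) (s : {perm 'I_n}) :
  set0 \in C -> setT \notin C ->
  [/\ (0 < first_hit C s <= n)%N, walk_vertex s (first_hit C s) \in C
    & forall j, (j < first_hit C s)%N -> walk_vertex s j \notin C].
Proof.
move=> C0 CT.
set a := fun j => walk_vertex s j \in C.
have hs : has a (iota 0 n.+1).
  by apply/hasP; exists n; rewrite ?mem_iota ?leq0n //= /a walk_vertex_last.
have fn : (first_hit C s < n.+1)%N by rewrite -[X in (_ < X)%N](size_iota 0) -has_find.
have hit : walk_vertex s (first_hit C s) \in C.
  by have := nth_find 0 hs; rewrite nth_iota.
split=> //.
  rewrite -[X in _ && X]ltnS fn andbT lt0n.
  by apply/eqP => e; move: hit; rewrite e walk_vertex0 (negbTE CT).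
move=> j jf; have := before_find 0 jf; rewrite nth_iota ?add0n => [/negbT //|].
exact: ltn_trans fn.
Qed.

(** The attached vertex is the one visited just before the first hit; it is new because the hit is
    the first one. *)
Lemma level_count_step n (C : {set {set 'I_n}}) (s : {perm 'I_n}) j :
  set0 \in C -> setT \notin C ->
  level_count (dla_step C s) j = (level_count C j + (first_hit C s == j.+1))%N.
Proof.
move=> C0 CT; have [/andP [f0 fn] _ fmin] := first_hitP s C0 CT.
set f := first_hit C s in f0 fn fmin *.
set v := walk_vertex s f.-1.
have vC : v \notin C by apply: fmin; rewrite prednK.
have cv : #|v| = (n - f.-1)%N by apply: card_walk_vertex.
have cvj : (#|v| + j == n)%N = (f == j.+1).
  by rewrite cv; apply/eqP/eqP; lia.
rewrite /level_count /dla_step -/f -/v.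
case: (f == j.+1) cvj => cvj.
  rewrite (_ : [set x in C :|: [set v] | _] = v |: [set x in C | #|x| + j == n]%N).
    by rewrite cardsU1 inE (negbTE vC) /= addnC.
  apply/setP => x; rewrite !inE orbC; case: eqP => [->|] //=; by rewrite cvj.
rewrite addn0; apply: eq_card => x; rewrite !inE andb_orl.
by case: (eqVneq x v) => [->|]; rewrite ?cvj ?orbF.
Qed.

Lemma card_dla_step n (C : {set {set 'I_n}}) (s : {perm 'I_n}) :
  set0 \in C -> setT \notin C -> #|dla_step C s| = #|C|.+1.
Proof.
move=> C0 CT; have [/andP [f0 _] _ fmin] := first_hitP s C0 CT.
rewrite /dla_step setUC cardsU1 fmin ?add1n //; by rewrite prednK.
Qed.

Lemma dla_step_set0 n (C : {set {set 'I_n}}) (s : {perm 'I_n}) :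
  set0 \in C -> set0 \in dla_step C s.
Proof. by rewrite !inE => ->. Qed.

(** * Averages over a uniform walk and hitting probabilities *)

Definition walk_mean n (g : {perm 'I_n} -> R) : R :=
  ((\sum_(s : {perm 'I_n}) g s) / (n`!)%:R)%R.

Lemma walk_mean_le n (f g : {perm 'I_n} -> R) :
  (forall s, f s <= g s) -> walk_mean f <= walk_mean g.
Proof. by move=> fg; rewrite ler_wpM2r ?invr_ge0 ?ler0n //; apply: ler_sum. Qed.

Lemma walk_meanD n (f g : {perm 'I_n} -> R) :
  walk_mean (fun s => f s + g s) = walk_mean f + walk_mean g.
Proof. by rewrite /walk_mean -mulrDl; congr (_ / _); apply: big_split. Qed.

Lemma walk_meanZ n (c : R) (f : {perm 'I_n} -> R) :
  walk_mean (fun s => c * f s) = c * walk_mean f.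
Proof. by rewrite /walk_mean -mulr_sumr mulrA. Qed.

Lemma walk_mean_const n (c : R) : walk_mean (fun _ : {perm 'I_n} => c) = c.
Proof.
rewrite /walk_mean sumr_const card_Sn -[X in X / _]mulr_natr mulfK // pnatr_eq0.
by rewrite -lt0n fact_gt0.
Qed.

Lemma walk_mean_hit n (C : {set {set 'I_n}}) j : (j <= n)%N ->
  walk_mean (fun s => (walk_vertex s j \in C)%:R)
    = (level_count C j)%:R / 'C(n, j)%:R.
Proof.
move=> jn; rewrite /walk_mean -natr_sum -big_mkcond /= sum1dep_card.
have b0 : 'C(n, j)%:R != 0 :> R by rewrite pnatr_eq0 -lt0n bin_gt0.
have f0 : (n`!)%:R != 0 :> R by rewrite pnatr_eq0 -lt0n fact_gt0.
apply/eqP; rewrite eqr_div // -!natrM -(card_walk_hit C jn).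
by apply/eqP; congr (_ * _)%:R; apply: eq_card.
Qed.

Lemma first_hit_mean_le n (C : {set {set 'I_n}}) j :
  set0 \in C -> setT \notin C -> (j <= n)%N ->
  walk_mean (fun s => (first_hit C s == j)%:R)
    <= (level_count C j)%:R / 'C(n, j)%:R.
Proof.
move=> C0 CT jn; rewrite -walk_mean_hit //; apply: walk_mean_le => s.
case: eqP => [<-|_]; last exact: ler0n.
by have [_ -> _] := first_hitP s C0 CT.
Qed.

Lemma first_hit_ge n (C : {set {set 'I_n}}) s h :
  set0 \in C -> setT \notin C -> (forall i, (i < h)%N -> level_count C i = 0) ->
  (h <= first_hit C s)%N.
Proof.
move=> C0 CT ch; rewrite leqNgt; apply/negP => /ch.
have [/andP [_ fn] hit _] := first_hitP s C0 CT.
by have := level_count_hit fn hit; case: level_count.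
Qed.

(** With all levels above [h] empty, a walk meeting the cluster at distance [h] cannot have met it
    earlier, so the bound of [first_hit_mean_le] is attained. *)
Lemma first_hit_mean n (C : {set {set 'I_n}}) h :
  set0 \in C -> setT \notin C -> (h <= n)%N ->
  (forall i, (i < h)%N -> level_count C i = 0) ->
  walk_mean (fun s => (first_hit C s == h)%:R)
    = (level_count C h)%:R / 'C(n, h)%:R.
Proof.
move=> C0 CT hn ch; rewrite -walk_mean_hit //; congr (_ / _).
apply: eq_bigr => s _; congr (_%:R); congr nat_of_bool.
have [_ hit fmin] := first_hitP s C0 CT.
apply/eqP/idP => [<- //|hC]; apply/eqP; rewrite eqn_leq first_hit_ge // andbT.
by rewrite leqNgt; apply/negP => /fmin; rewrite hC.
Qed.

(** * Expectations along the process *)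

Lemma dla_expect_top n fuel (C : {set {set 'I_n}}) f :
  setT \in C -> dla_expect fuel C f = f C.
Proof. by case: fuel => [|fuel] /= ->. Qed.

Lemma dla_expect0 n (C : {set {set 'I_n}}) f : dla_expect 0 C f = f C.
Proof. by rewrite /=; case: ifP. Qed.

Lemma dla_expectS n fuel (C : {set {set 'I_n}}) f : setT \notin C ->
  dla_expect fuel.+1 C f = walk_mean (fun s => dla_expect fuel (dla_step C s) f).
Proof. by move=> /negbTE CT /=; rewrite CT RdivE INRE. Qed.

Lemma dla_expect_lin n fuel (C : {set {set 'I_n}}) (c : R) f g :
  dla_expect fuel C (fun D => f D + c * g D)
    = dla_expect fuel C f + c * dla_expect fuel C g.
Proof.
elim: fuel C => [|fuel IH] C; first by rewrite !dla_expect0.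
have [CT|CT] := boolP (setT \in C); first by rewrite !dla_expect_top.
rewrite !dla_expectS // -walk_meanZ -walk_meanD; congr (_ / _).
by apply: eq_bigr => s _; rewrite IH.
Qed.

Lemma dla_expect_const n fuel (C : {set {set 'I_n}}) (c : R) :
  dla_expect fuel C (fun=> c) = c.
Proof.
elim: fuel C => [|fuel IH] C; first by rewrite dla_expect0.
have [CT|CT] := boolP (setT \in C); first by rewrite dla_expect_top.
rewrite dla_expectS // -[RHS](walk_mean_const n); congr (_ / _).
by apply: eq_bigr => s _; rewrite IH.
Qed.

Lemma dla_expect_ge n fuel (C : {set {set 'I_n}}) (f : {set {set 'I_n}} -> R) :
  (forall (D : {set {set 'I_n}}) s, set0 \in D -> setT \notin D -> f D <= f (dla_step D s)) ->
  set0 \in C -> f C <= dla_expect fuel C f.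
Proof.
move=> fmono; elim: fuel C => [|fuel IH] C C0; first by rewrite dla_expect0.
have [CT|CT] := boolP (setT \in C); first by rewrite dla_expect_top.
rewrite dla_expectS // -[X in X <= _](walk_mean_const n).
apply: walk_mean_le => s.
by apply: le_trans (IH _ (dla_step_set0 s C0)); apply: fmono.
Qed.

(** * Growth of a level once the top of the cluster has reached it *)

(* The last term is the trivial bound on the occupation number at distance [j + d]
   from the top: far down, nothing better is available. *)
Fixpoint level_tail n (lam : R) (d j : nat) (C : {set {set 'I_n}}) : R :=
  if d is e.+1 then ((level_count C j)%:R + lam * level_tail lam e j.+1 C)%R
  else ('C(n, j)%:R)%R.

(** Increment of [level_tail] when the first hit is at distance [f]; the constant last term
    contributes 0. *)
Fixpoint tail_incr (lam : R) (d j f : nat) : R :=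
  if d is e.+1 then ((f == j.+1)%:R + lam * tail_incr lam e j.+1 f)%R else 0%R.

Lemma level_tail_ge0 n lam d j (C : {set {set 'I_n}}) :
  0 <= lam -> 0 <= level_tail lam d j C.
Proof.
by move=> l0; elim: d j => [|d IH] j /=; rewrite ?addr_ge0 ?mulr_ge0 ?ler0n.
Qed.

Lemma tail_incr_ge0 lam d j f : 0 <= lam -> 0 <= tail_incr lam d j f.
Proof.
by move=> l0; elim: d j => [|d IH] j //=; rewrite addr_ge0 ?mulr_ge0 ?ler0n.
Qed.

Lemma level_tail_step n lam d j (C : {set {set 'I_n}}) s :
  set0 \in C -> setT \notin C ->
  level_tail lam d j (dla_step C s)
    = level_tail lam d j C + tail_incr lam d j (first_hit C s).
Proof.
move=> C0 CT; elim: d j => [|d IH] j /=; first by rewrite addr0.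
by rewrite level_count_step // natrD IH; ring.
Qed.

(** A first hit at distance [i] has probability at most [N_i / 'C(n, i)], which the factor [B] turns
    into at most [lam * N_i]: the sum shifts by one level. The deepest indicator is matched with the
    trivial last term of the shorter tail. *)
Lemma tail_incr_mean_le n (lam B : R) d j (C : {set {set 'I_n}}) :
  set0 \in C -> setT \notin C -> 0 <= lam -> 0 <= B -> (j + d < n)%N ->
  (forall i, (j < i <= j + d.+1)%N -> B <= lam * 'C(n, i)%:R) ->
  B * walk_mean (fun s => tail_incr lam d.+1 j (first_hit C s))
    <= lam * level_tail lam d j.+1 C.
Proof.
move=> C0 CT l0 B0.
have hitB i : (i <= n)%N -> B <= lam * 'C(n, i)%:R ->
    B * walk_mean (fun s => (first_hit C s == i)%:R) <= lam * (level_count C i)%:R.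
  move=> le_in Bi.
  have b0 : 0 < 'C(n, i)%:R :> R by rewrite ltr0n bin_gt0.
  apply: le_trans (ler_wpM2l B0 (first_hit_mean_le C0 CT le_in)) _.
  rewrite mulrA ler_pdivrMr // mulrAC.
  by apply: ler_wpM2r Bi; apply: ler0n.
elim: d j => [|d IH] j jn HB.
  rewrite /= walk_meanD walk_meanZ walk_mean_const mulr0 addr0.
  apply: le_trans (hitB _ _ (HB _ _)) _; rewrite ?addn0 ?addn1 ?leqnn //; try lia.
  by apply: ler_wpM2l => //; rewrite ler_nat level_count_le //; lia.
rewrite /= walk_meanD walk_meanZ mulrDr mulrDr (mulrCA B lam); apply: lerD.
  by apply: hitB; [lia | apply: HB; lia].
apply: ler_wpM2l => //; apply: IH; first lia.
by move=> i ?; apply: HB; lia.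
Qed.

(** While [i] is the highest occupied level, the mean waiting time for a hit there is at most
    ['C(n, i)]; these times are summed over the levels still to climb. *)
Definition bin_sum (n h : nat) : R := (\sum_(1 <= i < h.+1) 'C(n, i)%:R)%R.

Lemma bin_sum_ge0 n h : 0 <= bin_sum n h.
Proof. by apply: sumr_ge0 => i _; apply: ler0n. Qed.

Lemma bin_sumS n h : bin_sum n h.+1 = bin_sum n h + 'C(n, h.+1)%:R.
Proof. by rewrite /bin_sum [LHS]big_nat_recr. Qed.

Lemma bin_sum_mono n h h' : (h <= h')%N -> bin_sum n h <= bin_sum n h'.
Proof.
elim: h' => [|h' IH]; first by rewrite leqn0 => /eqP ->.
rewrite leq_eqVlt ltnS => /orP [/eqP -> //|/IH /le_trans]; apply.
by rewrite bin_sumS lerDl ler0n.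
Qed.

(** The only level above [h] that a step can occupy is the one at distance [h - 1], and only by a
    first hit at [h]. *)
Lemma level_count_step_below n (C : {set {set 'I_n}}) s h i :
  set0 \in C -> setT \notin C -> (forall i, (i < h)%N -> level_count C i = 0) ->
  (i.+1 < h)%N || (first_hit C s != h) && (i < h)%N ->
  level_count (dla_step C s) i = 0.
Proof.
move=> C0 CT ch ih; rewrite level_count_step // ch; last by lia.
have := first_hit_ge s C0 CT ch; case: eqP => // e hi.
by exfalso; case/orP: ih => [|/andP [/eqP]]; lia.
Qed.

(* [bin_sum n h] bounds the expected remaining time when [h] is the highest
   occupied level; the right-hand side is a supermartingale. *)
Lemma dla_expect_level_le n (lam : R) d j fuel (C : {set {set 'I_n}}) h :
  0 <= lam -> (j.+1 + d <= n)%N ->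
  (forall i, (j.+1 < i <= j.+1 + d)%N -> bin_sum n j <= lam * 'C(n, i)%:R) ->
  set0 \in C -> (0 < level_count C h)%N ->
  (forall i, (i < h)%N -> level_count C i = 0) -> (h <= j)%N ->
  dla_expect fuel C (fun D => (level_count D j)%:R)
    <= (level_count C j)%:R
       + bin_sum n h / 'C(n, j.+1)%:R * level_tail lam d j.+1 C.
Proof.
move=> l0 jdn Hlam.
have b0 i : (i <= n)%N -> 0 < 'C(n, i)%:R :> R by move=> ?; rewrite ltr0n bin_gt0.
have k0 : 0 < 'C(n, j.+1)%:R^-1 :> R by rewrite invr_gt0 b0 //; lia.
elim: fuel C h => [|fuel IH] C h C0 hpos hmin hj.
  rewrite dla_expect0 lerDl !mulr_ge0 ?bin_sum_ge0 ?level_tail_ge0 //.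
  exact: ltW.
have [CT|CT] := boolP (setT \in C).
  rewrite dla_expect_top // lerDl !mulr_ge0 ?bin_sum_ge0 ?level_tail_ge0 //.
  exact: ltW.
case: h hpos hmin hj => [|h] hpos hmin hj.
  by move: CT; rewrite -level_count_top hpos.
set k := 'C(n, j.+1)%:R^-1; set T := level_tail lam d j.+1 C.
set B := bin_sum n h.+1; set N := (level_count C j)%:R.
have kR : 0 < k by [].
(* The negative term is the drop of [bin_sum] from [h.+1] to [h] when the walk hits the highest
   occupied level. *)
have pt s : dla_expect fuel (dla_step C s) (fun D => (level_count D j)%:R) <=
    (N + B * k * T) + ((first_hit C s == j.+1)%:R
      + (k * (B * tail_incr lam d j.+1 (first_hit C s))
         + (- ('C(n, h.+1)%:R * k * T)) * (first_hit C s == h.+1)%:R)).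
  have fge := first_hit_ge s C0 CT hmin.
  have i0 := tail_incr_ge0 d j.+1 (first_hit C s) l0.
  case: (eqVneq (first_hit C s) h.+1) => fh.
    apply: le_trans (IH _ h (dla_step_set0 s C0) _ _ _) _.
    - by rewrite level_count_step // fh eqxx addn1.
    - move=> i ih; apply: (level_count_step_below C0 CT hmin).
      by rewrite ltnS ih.
    - by lia.
    rewrite level_tail_step // level_count_step // fh.
    rewrite (_ : (h.+1 == j.+1) = false); last by lia.
    have -> : tail_incr lam d j.+1 h.+1 = 0.
      elim: (d) (j.+1) (leqW hj : h < j.+1)%N => [//|e IHe] i hi /=.
      rewrite IHe; last by lia.
      by rewrite (_ : (h.+1 == i.+1) = false) ?mulr0 ?addr0 //; lia.
    rewrite addn0 -/N -/T -/k !addr0 /B bin_sumS /=; lra.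
  apply: le_trans (IH _ h.+1 (dla_step_set0 s C0) _ _ hj) _.
  - by rewrite level_count_step // ltn_addr.
  - move=> i ih; apply: (level_count_step_below C0 CT hmin).
    by rewrite fh ih orbT.
  by rewrite level_tail_step // level_count_step // natrD -/N -/T -/k -/B mulr0; lra.
rewrite dla_expectS //; apply: le_trans (walk_mean_le pt) _.
rewrite !walk_meanD !walk_meanZ !walk_mean_const.
rewrite (first_hit_mean C0 CT _ hmin); last by lia.
(* The mean gains controlled by [m1] and [m2] add up to at most [k * T]; by [m3] and [m4] the mean
   drop is at least [k * T], since the highest level holds at least one vertex. *)
have m1 : walk_mean (fun s => (first_hit C s == j.+1)%:R)
            <= (level_count C j.+1)%:R * k.
  by apply: first_hit_mean_le => //; lia.
have m2 : B * walk_mean (fun s => tail_incr lam d j.+1 (first_hit C s))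
            <= T - (level_count C j.+1)%:R.
  rewrite /T; case: (d) jdn Hlam => [|e] jdn Hlam.
    by rewrite /= walk_mean_const mulr0 subr_ge0 ler_nat level_count_le //; lia.
  apply: le_trans (tail_incr_mean_le C0 CT l0 (bin_sum_ge0 _ _) _ _) _.
  - by lia.
  - move=> i ?; apply: le_trans (bin_sum_mono _ _) (Hlam _ _) => //; lia.
  by rewrite /= addrC addKr.
have m3 : 'C(n, h.+1)%:R * k * T * ((level_count C h.+1)%:R / 'C(n, h.+1)%:R)
            = (level_count C h.+1)%:R * (k * T).
  by field; rewrite gt_eqF // b0 //; lia.
have T0 : 0 <= k * T by rewrite mulr_ge0 ?level_tail_ge0 // ltW.
have m4 : k * T <= (level_count C h.+1)%:R * (k * T).
  by rewrite ler_peMl // ler1n.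
have m5 := ler_wpM2l (ltW kR) m2.
rewrite mulNr m3; lra.
Qed.

(** * Growth of a level while the one above it is still empty *)

Lemma level_count_expect_ge n fuel (C : {set {set 'I_n}}) j :
  set0 \in C ->
  (level_count C j)%:R <= dla_expect fuel C (fun D => (level_count D j)%:R) :> R.
Proof.
move=> C0; apply: (@dla_expect_ge n fuel C (fun D => (level_count D j)%:R)) => //.
by move=> D s D0 DT; rewrite level_count_step // ler_nat leq_addr.
Qed.

Lemma level_tail_expect_ge n lam d fuel (C : {set {set 'I_n}}) j :
  0 <= lam -> set0 \in C ->
  level_tail lam d j C <= dla_expect fuel C (level_tail lam d j).
Proof.
move=> l0 C0; apply: dla_expect_ge => // D s D0 DT.
by rewrite level_tail_step // lerDl tail_incr_ge0.
Qed.

(** For [N >= 2] combine [c N <= c^2 + N^2 / 4] with [N^2 / 4 <= N (N - 1) / 2]; for [N <= 1] it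
    follows from [c >= 1]. *)
Lemma nat_le_quadratic (N : nat) (c : R) : 1 <= c ->
  N%:R <= c + c^-1 * (N%:R * (N%:R - 1) / 2).
Proof.
move=> c1; have c0 : 0 < c by lra.
rewrite -(ler_pM2l c0) mulrDr mulVKf ?gt_eqF //.
case: N => [|[|N]]; rewrite ?mulr0n; [nra | rewrite mulr1n; nra |].
have : 0 <= N%:R :> R by apply: ler0n.
rewrite -[N.+2]addn2 natrD; set x := N%:R => x0.
have := sqr_ge0 (c - (x + 2) / 2); nra.
Qed.

(* As long as nothing is occupied at distance [j], it is reached at the next step
   with probability exactly [N_(j+1) / 'C(n, j.+1)]. Hence the expectation of
   [N_(j+2)] at the time when it is reached is the sum over earlier times of those
   of [N_(j+1) N_(j+2) / 'C(n, j.+1)], which bounds the growth of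
   [N_(j+1) (N_(j+1) - 1) / 2]. Afterwards [dla_expect_level_le] applies. *)
Lemma dla_expect_level_le_quadratic n (lam c : R) d j fuel (C : {set {set 'I_n}}) :
  0 <= lam -> 1 <= c -> (j.+2 + d <= n)%N ->
  (forall i, (j.+2 < i <= j.+2 + d)%N -> bin_sum n j.+1 <= lam * 'C(n, i)%:R) ->
  set0 \in C -> (forall i, (i < j.+1)%N -> level_count C i = 0) ->
  dla_expect fuel C (fun D => (level_count D j.+1)%:R)
    <= c + c^-1 * ((level_count C j.+1)%:R * ((level_count C j.+1)%:R - 1) / 2
            + 'C(n, j.+1)%:R / 'C(n, j.+2)%:R
               * dla_expect fuel C (fun D => (level_count D j.+2)%:R))
       + bin_sum n j / 'C(n, j.+2)%:R * dla_expect fuel C (level_tail lam d j.+2).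
Proof.
move=> l0 c1 jdn Hlam.
have c0 : 0 < c^-1 by rewrite invr_gt0; lra.
have b0 i : (i <= n)%N -> 0 < 'C(n, i)%:R :> R by move=> ?; rewrite ltr0n bin_gt0.
set eps := 'C(n, j.+1)%:R / 'C(n, j.+2)%:R; set r := bin_sum n j / 'C(n, j.+2)%:R.
have e0 : 0 <= eps by rewrite mulr_ge0 ?invr_ge0 ?ler0n.
have r0 : 0 <= r by rewrite mulr_ge0 ?invr_ge0 ?ler0n ?bin_sum_ge0.
elim: fuel C => [|fuel IH] C C0 hmin.
  rewrite !dla_expect0; set N1 := (level_count C j.+2)%:R; set T := level_tail _ _ _ _.
  have := nat_le_quadratic (level_count C j.+1) c1; set q := _ / 2.
  have : 0 <= c^-1 * (eps * N1) by rewrite (mulr_ge0 (ltW c0)) // (mulr_ge0 e0) // ler0n.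
  have : 0 <= r * T by rewrite (mulr_ge0 r0) ?level_tail_ge0.
  by rewrite mulrDr; lra.
have CT : setT \notin C by rewrite -level_count_top hmin.
set N := (level_count C j.+1)%:R : R; set N1 := (level_count C j.+2)%:R : R.
rewrite !dla_expectS //.
set W1 := fun s => dla_expect fuel (dla_step C s) (fun D => (level_count D j.+2)%:R).
set T := fun s => dla_expect fuel (dla_step C s) (level_tail lam d j.+2).
(* A hit at [j.+2] raises [N (N - 1) / 2] by [N]. A hit at [j.+1] ends the phase; there
   [N1 <= W1 s], which leaves room for the negative term. *)
have pt s : dla_expect fuel (dla_step C s) (fun D => (level_count D j.+1)%:R) <=
    (c + c^-1 * (N * (N - 1) / 2)) + (c^-1 * N * (first_hit C s == j.+2)%:R
     + (c^-1 * eps * W1 s + (- (c^-1 * eps * N1) * (first_hit C s == j.+1)%:R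
     + r * T s))).
  have fge := first_hit_ge s C0 CT hmin.
  case: (eqVneq (first_hit C s) j.+1) => fh.
    apply: le_trans (dla_expect_level_le (d := d) fuel l0 _ Hlam (dla_step_set0 s C0) _ _ (leqnSn j)) _.
    - by lia.
    - by rewrite level_count_step // fh eqxx addn1.
    - move=> i ih; apply: (level_count_step_below C0 CT hmin).
      by rewrite ltnS ih.
    rewrite level_count_step // fh (_ : (j.+1 == j.+2) = false) ?addn0; last by lia.
    rewrite -/N -/r.
    have t1 : r * level_tail lam d j.+2 (dla_step C s) <= r * T s.
      by apply: ler_wpM2l => //; apply: level_tail_expect_ge => //; apply: dla_step_set0.
    have t2 : N1 <= W1 s.
      apply: le_trans (level_count_expect_ge fuel j.+2 (dla_step_set0 s C0)).
      by rewrite level_count_step // ler_nat leq_addr.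
    have t3 := nat_le_quadratic (level_count C j.+1) c1.
    have t4 : c^-1 * eps * N1 <= c^-1 * eps * W1 s.
      by apply: ler_wpM2l => //; rewrite (mulr_ge0 (ltW c0)).
    rewrite -/N in t3; rewrite mulr0 mulr1; lra.
  apply: le_trans (IH _ (dla_step_set0 s C0) _) _.
    move=> i ih; apply: (level_count_step_below C0 CT hmin).
    by rewrite fh ih orbT.
  rewrite level_count_step // natrD -/N -/(W1 s) -/(T s) mulr0.
  by case: eqP => _; rewrite ?mulr0n ?mulr1n ?mulr1 ?mulr0 ?addr0; lra.
apply: le_trans (walk_mean_le pt) _.
rewrite !walk_meanD !walk_meanZ !walk_mean_const -/N.
rewrite (first_hit_mean C0 CT _ hmin); last by lia.
have m1 : c^-1 * N * walk_mean (fun s => (first_hit C s == j.+2)%:R)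
            <= c^-1 * N * (N1 / 'C(n, j.+2)%:R).
  apply: ler_wpM2l; first by rewrite mulr_ge0 ?ler0n // ltW.
  by apply: first_hit_mean_le => //; lia.
(* The ratio [eps] is exactly what makes the negative term cancel the mean growth of the quadratic
   one. *)
have m2 : - (c^-1 * eps * N1) * (N / 'C(n, j.+1)%:R)
           = - (c^-1 * N * (N1 / 'C(n, j.+2)%:R)).
  rewrite /eps; field; rewrite !gt_eqF ?b0 //; try lia.
  by lra.
rewrite -/N m2; lra.
Qed.

(** * Recursion for the expected occupation numbers *)

Lemma level_count_start n i : (i < n)%N -> level_count [set set0 : {set 'I_n}] i = 0%N.
Proof.
move=> lt_in; apply/eqP; rewrite cards_eq0; apply/eqP/setP => x; rewrite !inE.
by apply/negP => /andP [/eqP -> /eqP]; rewrite cards0; lia.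
Qed.

(** Up to distance [J] the binomials grow at least geometrically; the cap [1 / 4] keeps the
    resulting sums within constant factors. *)
Definition bin_growth (n J : nat) (eps : R) : Prop :=
  [/\ 0 < eps, eps <= 1 / 4, (J <= n)%N &
      forall i, (i < J)%N -> 'C(n, i)%:R <= eps * 'C(n, i.+1)%:R :> R].

Lemma bin_sum_le n J (eps : R) j : bin_growth n J eps ->
  (j <= J)%N -> bin_sum n j <= 2 * 'C(n, j)%:R.
Proof.
case=> e0 e4 _ gr; elim: j => [|j IH] jJ.
  by rewrite /bin_sum big_geq // mulr_ge0 ?ler0n.
have := IH (ltnW jJ); have := gr _ jJ; rewrite bin_sumS.
have : 0 <= 'C(n, j.+1)%:R :> R by apply: ler0n.
by move: ('C(n, j)%:R) ('C(n, j.+1)%:R) => u v; nra.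
Qed.

Lemma bin_growth_mono n J (eps : R) i j : bin_growth n J eps ->
  (i <= j <= J)%N -> 'C(n, i)%:R <= 'C(n, j)%:R :> R.
Proof.
case=> e0 e4 _ gr /andP [ij jJ]; elim: j ij jJ => [|j IH] ij jJ.
  by move: ij; rewrite leqn0 => /eqP ->.
move: ij; rewrite leq_eqVlt ltnS => /orP [/eqP -> //|ij].
apply: le_trans (IH ij (ltnW jJ)) _; apply: le_trans (gr _ jJ) _.
by rewrite ler_piMl ?ler0n //; lra.
Qed.

Lemma bin_growth2 n J (eps : R) i : bin_growth n J eps ->
  (i.+1 < J)%N -> 'C(n, i)%:R <= eps ^+ 2 * 'C(n, i.+2)%:R :> R.
Proof.
case=> e0 _ _ gr iJ; apply: le_trans (gr _ (ltnW iJ)) _.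
by rewrite expr2 -mulrA ler_wpM2l ?gr // ltW.
Qed.

Definition expect_level (n fuel j : nat) : R :=
  dla_expect fuel [set set0 : {set 'I_n}] (fun D => (level_count D j)%:R%R).

Definition expect_tail (n fuel : nat) (lam : R) (d j : nat) : R :=
  dla_expect fuel [set set0 : {set 'I_n}] (level_tail lam d j).

Lemma expect_level_ge0 n fuel j : 0 <= expect_level n fuel j.
Proof.
apply: le_trans (level_count_expect_ge fuel j _); first exact: ler0n.
by rewrite inE.
Qed.

Lemma expect_tail_ge0 n fuel lam d j : 0 <= lam -> 0 <= expect_tail n fuel lam d j.
Proof.
move=> l0; apply: le_trans (level_tail_expect_ge d fuel j l0 _).
  exact: level_tail_ge0.
by rewrite inE.
Qed.

Lemma expect_tail0 n fuel lam j : expect_tail n fuel lam 0 j = 'C(n, j)%:R.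
Proof. exact: (dla_expect_const fuel _ ('C(n, j)%:R)%R). Qed.

Lemma expect_tailS n fuel lam d j :
  expect_tail n fuel lam d.+1 j
    = expect_level n fuel j + lam * expect_tail n fuel lam d j.+1.
Proof. exact: dla_expect_lin. Qed.

Lemma expect_level_le_bin n fuel j : (j <= n)%N ->
  expect_level n fuel j <= 'C(n, j)%:R.
Proof.
move=> jn; rewrite /expect_level.
elim: fuel [set set0] => [|m IH] C.
  by rewrite dla_expect0 ler_nat level_count_le.
have [CT|CT] := boolP (setT \in C).
  by rewrite dla_expect_top // ler_nat level_count_le.
by rewrite dla_expectS // -[leRHS](walk_mean_const n); apply: walk_mean_le.
Qed.

Lemma expect_level_le_tail n fuel lam d j : 0 <= lam -> (j + d <= n)%N ->
  expect_level n fuel j <= expect_tail n fuel lam d j.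
Proof.
move=> l0; case: d => [|d] jn.
  by rewrite expect_tail0 expect_level_le_bin //; lia.
by rewrite expect_tailS lerDl mulr_ge0 ?expect_tail_ge0.
Qed.

(** The weight [2 * eps ^+ 2] is admissible because [bin_sum] at [j.+1] is at most twice its last
    binomial, which is compared with binomials at least two levels deeper. The quadratic term
    vanishes at the start, where level [j.+1] is empty. *)
Lemma expect_level_rec n fuel J (eps c : R) d j :
  bin_growth n J eps -> 1 <= c -> (j.+2 + d = J)%N ->
  expect_level n fuel j.+1
    <= c + (eps / c + 2 * eps ^+ 2) * expect_tail n fuel (2 * eps ^+ 2)%R d j.+2.
Proof.
move=> bg c1 jd; have [e0 e4 Jn gr] := bg.
have b0 i : (i <= n)%N -> 0 < 'C(n, i)%:R :> R by move=> ?; rewrite ltr0n bin_gt0.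
have c0 : 0 < c^-1 by rewrite invr_gt0; lra.
have l0 : 0 <= 2 * eps ^+ 2 by rewrite mulr_ge0 ?sqr_ge0.
apply: le_trans (dla_expect_level_le_quadratic (d := d) fuel l0 c1 _ _ _ _) _.
- by lia.
- move=> i ij; apply: le_trans (bin_sum_le bg _) _; first by lia.
  rewrite -mulrA ler_wpM2l //.
  apply: le_trans (bin_growth2 bg _) _; first by lia.
  by rewrite ler_wpM2l ?sqr_ge0 // (bin_growth_mono bg) //; lia.
- by rewrite inE.
- by move=> i ?; rewrite level_count_start //; lia.
rewrite -/(expect_level n fuel j.+2) -/(expect_tail n fuel (2 * eps ^+ 2)%R d j.+2).
have VS : expect_level n fuel j.+2 <= expect_tail n fuel (2 * eps ^+ 2)%R d j.+2.
  by apply: expect_level_le_tail => //; lia.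
have S0 := expect_tail_ge0 n fuel d j.+2 l0.
rewrite level_count_start; last by lia.
rewrite mul0r mul0r add0r (mulrDl (eps / c)) addrA; apply: lerD; [apply: lerD => //|].
  rewrite (mulrC eps) -[leRHS]mulrA; apply: ler_wpM2l; first exact: ltW.
  apply: ler_pM => //; rewrite ?mulr_ge0 ?invr_ge0 ?ler0n ?expect_level_ge0 //.
  by rewrite ler_pdivrMr ?b0 ?gr //; lia.
apply: ler_wpM2r => //; rewrite ler_pdivrMr ?b0 //; last by lia.
apply: le_trans (bin_sum_le bg _) _; first by lia.
by rewrite -mulrA ler_wpM2l // (bin_growth2 bg) //; lia.
Qed.

Lemma expect_tail_rec n fuel J (eps c : R) d j :
  bin_growth n J eps -> 1 <= c -> (j.+2 + d = J)%N ->
  expect_tail n fuel (2 * eps ^+ 2)%R d.+1 j.+1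
    <= c + (eps / c + 4 * eps ^+ 2) * expect_tail n fuel (2 * eps ^+ 2)%R d j.+2.
Proof.
move=> bg c1 jd; rewrite expect_tailS; have := expect_level_rec fuel bg c1 jd.
by lra.
Qed.

(** With [c = 1 / eps] the recursion becomes [S_j <= 1 / eps + 5 eps^2 S_(j+1)], and [2 / eps]
    absorbs the constant as [10 eps^2 <= 1]. *)
Lemma expect_tail_le n fuel J (eps : R) d j :
  bin_growth n J eps -> (j.+1 + d = J)%N ->
  expect_tail n fuel (2 * eps ^+ 2)%R d j.+1
    <= 2 / eps + (5 * eps ^+ 2) ^+ d * 'C(n, J)%:R.
Proof.
move=> bg; have [e0 e4 _ _] := bg; elim: d j => [|d IH] j jd.
  by rewrite expect_tail0 -jd addn0 expr0 mul1r lerDr divr_ge0 // ltW.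
have ei1 : 1 <= eps^-1 by rewrite invf_ge1 //; lra.
have jd' : (j.+2 + d = J)%N by lia.
apply: le_trans (expect_tail_rec fuel bg ei1 jd') _.
rewrite invrK -expr2 (exprS _ d).
have := IH j.+1 jd'; set Z := (5 * eps ^+ 2) ^+ d * 'C(n, J)%:R.
have E : eps ^+ 2 * eps^-1 = eps by field; rewrite gt_eqF.
have q0 : 0 <= eps ^+ 2 by apply: sqr_ge0.
rewrite -(mulrA _ _ ('C(n, J)%:R)) -/Z.
set s := expect_tail _ _ _ _ _; move=> h.
have := ler_wpM2l q0 h; rewrite mulrDr mulrCA E.
have : 4 <= eps^-1 by rewrite -div1r ler_pdivlMr //; lra.
by lra.
Qed.

(** The smallness hypothesis gives tails at most [3 / eps]. Each round with [c = 1] multiplies by at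
    most [2 eps] and adds 1: the first yields [1 + 6 = 7], the second [1 + 14 eps]. *)
Lemma expect_level_top n fuel J (eps : R) m j :
  bin_growth n J eps -> (m.+2 <= J)%N ->
  (5 * eps ^+ 2) ^+ (J - m.+2) * 'C(n, J)%:R <= 1 ->
  (0 < j <= m)%N -> expect_level n fuel j <= 1 + 14 * eps.
Proof.
move=> bg mJ small; have [e0 e4 _ _] := bg.
have e2 : eps ^+ 2 <= eps / 4 by rewrite expr2; nra.
have e20 : 0 <= eps ^+ 2 by apply: sqr_ge0.
have l0 : 0 <= 2 * eps ^+ 2 by lra.
pose S i := expect_tail n fuel (2 * eps ^+ 2)%R (J - i) i.
have S0 i : 0 <= S i by apply: expect_tail_ge0.
have S3 i : (i < m.+2)%N -> S i.+1 <= 3 / eps.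
  move=> im; apply: le_trans (expect_tail_le _ bg _) _; first by lia.
  have -> : 3 / eps = 2 / eps + eps^-1 by field; rewrite gt_eqF.
  rewrite lerD2l; apply: le_trans (_ : _ <= 1) _; last by rewrite invf_ge1 //; lra.
  apply: le_trans small; rewrite ler_wpM2r ?ler0n //.
  by apply: ler_wiXn2l; [lra | lra | lia].
have S7 i : (i < m.+1)%N -> S i.+1 <= 7.
  move=> im; rewrite /S (_ : J - i.+1 = (J - i.+2).+1)%N; last by lia.
  apply: le_trans (expect_tail_rec _ bg (lexx 1) _) _; first by lia.
  have E : eps * (3 / eps) = 3 by field; rewrite gt_eqF.
  rewrite -/(S i.+2) invr1 mulr1.
  have : (eps + 4 * eps ^+ 2) * S i.+2 <= (2 * eps) * (3 / eps).
    by apply: ler_pM; rewrite ?S0 ?S3 //; lra.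
  by rewrite -mulrA E; lra.
case: j => // j jm.
apply: le_trans (expect_level_rec _ bg (lexx 1) (_ : j.+2 + (J - j.+2) = J)%N) _.
  by lia.
rewrite -/(S j.+2) invr1 mulr1 lerD2l (_ : 14 * eps = (2 * eps) * 7); last by lra.
by apply: ler_pM; rewrite ?S0 ?S7 //; lra.
Qed.

(** * Binomial estimates *)

Lemma bin_le_expn n k : ('C(n, k) <= n ^ k)%N.
Proof.
apply: leq_trans (_ : n ^_ k <= _)%N.
  by rewrite -bin_ffact leq_pmulr // fact_gt0.
elim: k => [|k IH]; first by rewrite ffactn0 expn0.
by rewrite ffactnSr expnSr leq_mul // leq_subr.
Qed.

(** Consecutive binomials have ratio [(i + 1) / (n - i)], where [i + 1 <= J] and
    [n - i >= n / 2]. *)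
Lemma bin_growth_ratio n J : (0 < J)%N -> (8 * J <= n)%N ->
  bin_growth n J (2 * J%:R / n%:R)%R.
Proof.
move=> J0 Jn; have n0 : 0 < n%:R :> R by rewrite ltr0n; lia.
have J0' : 0 < J%:R :> R by rewrite ltr0n.
split.
- by rewrite divr_gt0 // mulr_gt0.
- rewrite ler_pdivrMr //; have : (8 * J)%:R <= n%:R :> R by rewrite ler_nat.
  by rewrite natrM; lra.
- by lia.
move=> i iJ; rewrite mulrAC ler_pdivlMr // -!natrM ler_nat.
apply: leq_trans (_ : 2 * ((n - i) * 'C(n, i)) <= _)%N.
  by rewrite mulnA mulnC leq_mul2r; apply/orP; right; lia.
by rewrite -mul_bin_left mulnA leq_mul2r; apply/orP; right; lia.
Qed.

(** * From expectations to the probability of unique top levels *)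

Lemma eq_dla_expect n fuel (C : {set {set 'I_n}}) f g :
  f =1 g -> dla_expect fuel C f = dla_expect fuel C g.
Proof.
move=> fg; elim: fuel C => [|fuel IH] C; first by rewrite !dla_expect0.
have [CT|CT] := boolP (setT \in C); first by rewrite !dla_expect_top.
by rewrite !dla_expectS //; congr (_ / _); apply: eq_bigr => s _.
Qed.

(** Every step adds a new vertex, so the fuel cannot run out before termination. Occupied levels
    always form an interval reaching down to the bottom, so a final cluster meets every level. *)
Lemma dla_expect_le_final n fuel (C : {set {set 'I_n}}) (f g : {set {set 'I_n}} -> R) :
  (forall D : {set {set 'I_n}}, setT \in D -> (forall k, (k <= n)%N -> (0 < level_count D k)%N) ->
     f D <= g D) ->
  set0 \in C -> (2 ^ n < #|C| + fuel)%N ->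
  (forall i k, (i <= k <= n)%N -> (0 < level_count C i)%N -> (0 < level_count C k)%N) ->
  dla_expect fuel C f <= dla_expect fuel C g.
Proof.
move=> fg; elim: fuel C => [|fuel IH] C C0 Cfuel Cc;
    (have [CT|CT] := boolP (setT \in C);
      [rewrite !dla_expect_top //; apply: fg => // k kn;
       by apply: (Cc 0%N); rewrite ?level_count_top|]).
  have : (#|C| <= 2 ^ n)%N.
    rewrite -[X in (2 ^ X)%N]card_ord -cardsT -card_powerset subset_leq_card //.
    by apply/subsetP => x _; rewrite powersetE subsetT.
  by move: Cfuel; rewrite addn0 ltnNge => /negbTE ->.
rewrite !dla_expectS //; apply: walk_mean_le => s; apply: IH.
- exact: dla_step_set0.
- by rewrite card_dla_step // addSnnS.
have [/andP [f0 fn] hit _] := first_hitP s C0 CT.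
move=> i k /andP [ik kn]; rewrite !level_count_step // !addn_gt0.
case/orP => [Ci|]; first by rewrite (Cc i) ?ik.
case: eqP => // fi _; case: (ltnP i k) => ik'.
  by rewrite (Cc i.+1) ?ik' ?kn // -fi (level_count_hit fn hit).
by rewrite (_ : k = i) ?fi ?eqxx ?orbT //; lia.
Qed.

Lemma start_contiguous n i k : (i <= k <= n)%N ->
  (0 < level_count [set set0 : {set 'I_n}] i)%N ->
  (0 < level_count [set set0 : {set 'I_n}] k)%N.
Proof.
move=> /andP [ik kn]; case: (ltnP i n) => lt_in; first by rewrite level_count_start.
by rewrite (_ : k = i) //; lia.
Qed.

(* The exponentiation in the definition of [dla_prob] is [Nat.pow]. *)
Lemma dla_probE n (E : pred {set {set 'I_n}}) :
  dla_prob E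
    = dla_expect (2 ^ n) [set set0 : {set 'I_n}] (fun D => if E D then R1 else R0).
Proof.
rewrite /dla_prob; congr dla_expect.
by elim: n {E} => // n IH; rewrite expnS -IH /=; lia.
Qed.

Lemma dla_prob_le1 n (E : pred {set {set 'I_n}}) : dla_prob E <= 1.
Proof.
rewrite -[leRHS](dla_expect_const (2 ^ n) [set set0 : {set 'I_n}] 1%R).
rewrite dla_probE; apply: dla_expect_le_final; rewrite ?inE ?cards1 ?add1n //.
  by move=> D _ _; case: (E D).
exact: start_contiguous.
Qed.

Lemma expect_excess_le n fuel m (del : R) :
  (forall j, (0 < j <= m)%N -> expect_level n fuel j <= 1 + del) ->
  dla_expect fuel [set set0 : {set 'I_n}]
    (fun D => \sum_(1 <= j < m.+1) ((level_count D j)%:R - 1)) <= m%:R * del.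
Proof.
elim: m => [|m IH] Hdel.
  rewrite (@eq_dla_expect _ _ _ _ (fun=> 0%R)); last by move=> D; rewrite big_geq.
  by rewrite dla_expect_const mul0r.
rewrite (@eq_dla_expect _ _ _ _ (fun D => (\sum_(1 <= j < m.+1) ((level_count D j)%:R - 1)
   + 1 * ((level_count D m.+1)%:R + (-1) * 1))%R)); last first.
  by move=> D; rewrite [LHS]big_nat_recr //= mul1r mulr1.
rewrite !dla_expect_lin dla_expect_const -/(expect_level n fuel m.+1).
have h1 : expect_level n fuel m.+1 <= 1 + del by apply: Hdel; rewrite leqnn.
have h2 : dla_expect fuel [set set0 : {set 'I_n}]
    (fun D => \sum_(1 <= j < m.+1) ((level_count D j)%:R - 1)) <= m%:R * del.
  by apply: IH => j jm; apply: Hdel; lia.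
by rewrite -natr1; lra.
Qed.

Lemma not_top_levels_unique n m (a : R) (D : {set {set 'I_n}}) :
  Rpower (INR n) a <= m%:R -> setT \in D ->
  (forall k, (k <= n)%N -> (0 < level_count D k)%N) ->
  ~~ top_levels_unique n a D -> exists2 j, (0 < j <= minn m n)%N & (1 < level_count D j)%N.
Proof.
move=> am DT Dpos; rewrite negb_forall => /existsP [k].
rewrite negb_imply; case: Rle_dec => //= hk cnt.
have kn : (k <= n)%N by rewrite -ltnS.
have lvlE : level_count D (n - k) = #|[set x in D | #|x| == val k]|.
  apply: eq_card => x; rewrite !inE; congr (_ && _).
  by apply/eqP/eqP => /=; lia.
have lvl2 : (1 < level_count D (n - k))%N.
  by have := Dpos (n - k)%N (leq_subr _ _); rewrite lvlE; case: #|_| cnt => [|[]].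
exists (n - k)%N => //; apply/andP; split.
  (* Distance 0 is excluded because that level has a single vertex. *)
  rewrite lt0n; apply/eqP => k0; move: lvl2; rewrite k0.
  by have := @level_count_le n D 0 (leq0n _); rewrite bin0; lia.
rewrite leq_min leq_subr andbT -(ler_nat R) natrB //.
move/RleP: hk; rewrite RminusE !INRE => hk; rewrite INRE in am; lra.
Qed.

(** A Markov bound: on final clusters every excess [N_j - 1] is nonnegative, and failure makes one
    of them at least 1. *)
Lemma dla_prob_ge n m (a del : R) :
  Rpower (INR n) a <= m%:R -> (m <= n)%N ->
  (forall j, (0 < j <= m)%N -> expect_level n (2 ^ n) j <= 1 + del) ->
  1 - m%:R * del <= dla_prob (top_levels_unique n a).
Proof.
move=> am mn Hdel.
have := expect_excess_le Hdel; set x := dla_expect _ _ _ => xle.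
apply: le_trans (_ : 1 + (-1) * x <= _); first by lra.
rewrite -[X in X + _](dla_expect_const (2 ^ n) [set set0 : {set 'I_n}] 1%R).
rewrite -dla_expect_lin.
rewrite dla_probE; apply: dla_expect_le_final; rewrite ?inE ?cards1 ?add1n //; last exact: start_contiguous.
move=> D DT Dpos.
have nn j : (0 < j <= m)%N -> 0 <= (level_count D j)%:R - 1 :> R.
  by move=> jm; rewrite subr_ge0 ler1n Dpos //; lia.
have s0 : 0 <= \sum_(1 <= j < m.+1) ((level_count D j)%:R - 1) :> R.
  by rewrite big_nat_cond; apply: sumr_ge0 => j; rewrite andbT => ?; apply: nn; lia.
apply: le_trans (_ : _ <= (top_levels_unique n a D)%:R) _; last by case: ifP.
have [U|U] := boolP (top_levels_unique n a D); first by rewrite mulN1r mulr1n; lra.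
have [j jm j2] := not_top_levels_unique am DT Dpos U.
suff : 1 <= \sum_(1 <= j < m.+1) ((level_count D j)%:R - 1) :> R by rewrite mulN1r /= mulr0n; lra.
rewrite (bigD1_seq j) ?mem_index_iota ?iota_uniq //=; last by lia.
rewrite -[leLHS]addr0; apply: lerD.
  by rewrite lerBrDr (_ : 1 + 1 = 2%:R) ?ler_nat //; lra.
rewrite big_nat_cond; apply: sumr_ge0 => i ?; apply: nn; lia.
Qed.

(** * Choice of parameters and the limit *)

(** Here [x] and [z] stand for [n^b] and [n^(1/2 - b)]. The bound [80 l^2 <= z] gives
    [5 eps^2 <= 1 / (n z)], so the initial error is at most [(n^2 / z^K)^m <= 1]. The loss is
    [14 m eps = 28 l m^2 / n], with [m^2 / n <= 4 / z^2]. *)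
Lemma dla_prob_lower_bound n K (a x z : R) :
  1 <= x -> 1 <= z -> x ^+ 2 * z ^+ 2 = n%:R -> Rpower (INR n) a <= x ->
  80 * K.+2%:R ^+ 2 <= z -> n%:R ^+ 2 <= z ^+ K ->
  1 - 112 * K.+2%:R / z <= dla_prob (top_levels_unique n a).
Proof.
move=> x1 z1 xzn ax zL nzK.
have x0 : 0 <= x by lra.
have n1 : 1 <= n%:R :> R by rewrite -xzn -exprMn -(expr1n _ 2) lerXn2r ?nnegrE; nra.
have n0 : 0 < n%:R :> R by lra.
(* The bound [2 <= m] ensures [K * m <= J - m.+2] for [J = K.+2 * m]. *)
have [m [m2 mx xm]] : exists m : nat, [/\ (2 <= m)%N, m%:R <= 2 * x & x <= m%:R].
  have /andP [tx xt] := truncn_itv x0.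
  exists (Num.truncn x).+1; rewrite -natr1 in xt *; split; [|lra|lra].
  by rewrite ltnS lt0n; apply/eqP => e; move: xt; rewrite e; lra.
have m0 : 0 <= m%:R :> R by apply: ler0n.
set l := K.+2%:R : R.
have l2 : 2 <= l by rewrite /l ler_nat.
have lz : 16 * l <= z by rewrite -/l expr2 in zL; nra.
pose J := (K.+2 * m)%N.
have Jn : (8 * J <= n)%N.
  rewrite -(ler_nat R) natrM natrM -/l -xzn.
  apply: le_trans (_ : 16 * l * x <= _); first by nra.
  rewrite !expr2; apply: le_trans (_ : z * x <= _); first by nra.
  by rewrite mulrACA mulrC ler_peMr //; nra.
have J0 : (0 < J)%N by rewrite /J muln_gt0 (ltnW m2).
have bg := bin_growth_ratio J0 Jn.
set eps := 2 * J%:R / n%:R in bg.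
have [e0 e4 _ _] := bg.
have mm : m%:R ^+ 2 <= 4 * x ^+ 2 by rewrite !expr2; nra.
have xn : x ^+ 2 = n%:R / z ^+ 2 by rewrite -xzn mulfK // sqrf_eq0; lra.
have q1 : 5 * eps ^+ 2 <= (n%:R * z)^-1.
  have -> : 5 * eps ^+ 2 = (20 * l ^+ 2 * m%:R ^+ 2) / n%:R ^+ 2.
    by rewrite /eps /J natrM -/l; field; rewrite gt_eqF.
  rewrite ler_pdivrMr ?exprn_gt0 //.
  have -> : (n%:R * z)^-1 * n%:R ^+ 2 = n%:R / z.
    by field; rewrite !gt_eqF //; lra.
  apply: le_trans (_ : z * x ^+ 2 <= _).
    apply: le_trans (_ : 20 * l ^+ 2 * (4 * x ^+ 2) <= _).
      by rewrite ler_wpM2l // mulr_ge0 ?sqr_ge0.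
    rewrite mulrA ler_wpM2r ?sqr_ge0 //; rewrite -/l in zL; lra.
  by rewrite xn le_eqVlt; apply/orP; left; apply/eqP; field; rewrite gt_eqF //; lra.
have q0 : 0 <= 5 * eps ^+ 2 by rewrite mulr_ge0 ?sqr_ge0.
have q2 : 5 * eps ^+ 2 <= 1 by rewrite expr2; nra.
have small : (5 * eps ^+ 2) ^+ (J - m.+2) * 'C(n, J)%:R <= 1.
  apply: le_trans (_ : (5 * eps ^+ 2) ^+ (K * m) * n%:R ^+ J <= _).
    apply: ler_pM; rewrite ?exprn_ge0 ?ler0n //.
      by apply: ler_wiXn2l => //; rewrite /J; clear -m2; nia.
    by rewrite -natrX ler_nat bin_le_expn.
  rewrite /J !exprM -exprMn exprn_ile1 //.
    by rewrite mulr_ge0 ?exprn_ge0 ?ler0n.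
  apply: le_trans (_ : (n%:R * z)^-1 ^+ K * n%:R ^+ K.+2 <= _).
    by rewrite ler_wpM2r ?exprn_ge0 ?ler0n // lerXn2r ?nnegrE // invr_ge0; nra.
  have zK : 0 < z ^+ K by rewrite exprn_gt0 //; lra.
  have -> : (n%:R * z)^-1 ^+ K * n%:R ^+ K.+2 = n%:R ^+ 2 / z ^+ K.
    rewrite -addn2 exprD exprVn exprMn; field.
    by rewrite !gt_eqF // exprn_gt0.
  by rewrite ler_pdivrMr // mul1r.
have mJ : (m.+2 <= J)%N by rewrite /J; clear -m2; nia.
have am : Rpower (INR n) a <= m%:R by lra.
have mn : (m <= n)%N by apply: leq_trans Jn; rewrite /J; clear -m2; nia.
apply: le_trans (dla_prob_ge am mn (fun j => expect_level_top _ bg mJ small)).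
rewrite lerB //.
have -> : m%:R * (14 * eps) = 28 * l * (m%:R ^+ 2 / n%:R).
  by rewrite /eps /J natrM -/l; field; rewrite gt_eqF.
have : m%:R ^+ 2 / n%:R <= 4 / z.
  rewrite ler_pdivrMr //; apply: le_trans mm _; rewrite xn.
  have -> : 4 / z * n%:R = 4 * (n%:R / z) by field; rewrite gt_eqF //; lra.
  rewrite ler_wpM2l // ler_wpM2l ?ler0n // lef_pV2 ?posrE ?exprn_gt0; try lra.
  by rewrite expr2; nra.
move: (m%:R ^+ 2 / n%:R) => w h.
have -> : 112 * l / z = 28 * l * (4 / z) by field; rewrite gt_eqF //; lra.
by rewrite ler_wpM2l //; lra.
Qed.

Lemma Rpower_unbounded (t M : R) : 0 < t ->
  exists N : nat, forall n, (N <= n)%N -> M <= Rpower n%:R t.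
Proof.
move=> t0; pose M' := Num.max M 1.
have M0 : 0 < M' by rewrite lt_max ltr01 orbT.
have y0 : 0 <= Rpower M' t^-1 by apply/RleP/Rlt_le/exp_pos.
exists (Num.truncn (Rpower M' t^-1)).+1 => n Nn.
apply: le_trans (_ : M' <= _); first by rewrite le_max lexx.
have -> : M' = Rpower (Rpower M' t^-1) t.
  rewrite Rpower_mult RmultE mulVf ?gt_eqF // Rpower_1 //.
  exact/RltP.
apply/RleP/Rle_Rpower_l; first exact/RleP/ltW.
split; first exact: exp_pos.
apply/RleP; have /andP [_ /ltW /le_trans] := truncn_itv y0; apply.
by rewrite ler_nat.
Qed.

Lemma dla_prob_cvg (a : R) : a < 2^-1 ->
  Un_cv (fun n : nat => dla_prob (top_levels_unique n a)) R1.
Proof.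
(* Raising [a] to at least [1 / 4] keeps [b < 1 / 2] and ensures [n^b >= 1] even for negative
   [a]. *)
move=> a2; pose b := Num.max a 4^-1.
have ab : a <= b by rewrite le_max lexx.
have b4 : 4^-1 <= b by rewrite le_max lexx orbT.
have b2 : b < 2^-1 by rewrite gt_max a2; lra.
pose t := 2^-1 - b; have t0 : 0 < t by rewrite /t; lra.
(* This makes [z^K = n^(t K)] at least [n^2]. *)
have [K Kt] : exists K : nat, 2 <= t * K%:R.
  exists (Num.truncn (2 / t)).+1; rewrite mulrC -ler_pdivrMr //.
  have t20 : 0 <= 2 / t by rewrite divr_ge0 // ltW.
  by have /andP [_ /ltW] := truncn_itv t20.
move=> e /RltP e0.
pose l := K.+2%:R : R.
(* One threshold for both needs: [80 l^2 <= z], and [113 l / e <= z], which makes the loss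
   [112 l / z] less than [e]. *)
have [N HN] := Rpower_unbounded (80 * l ^+ 2 + 113 * (l / e))%R t0.
exists N.+1 => n /ssrnat.leP Nn.
have n1 : 1 <= n%:R :> R by rewrite ler1n; lia.
have n0 : Rlt 0 n%:R by apply/RltP; apply: lt_le_trans ltr01 n1.
set z := Rpower n%:R t; set x := Rpower n%:R b.
have := HN n (ltnW Nn); rewrite -/z => zN.
have l2 : 2 <= l by rewrite /l ler_nat.
have le0 : 0 < l / e by rewrite divr_gt0 //; lra.
have ll : 4 <= l ^+ 2 by rewrite expr2; nra.
have z1 : 1 <= z by lra.
have x1 : 1 <= x.
  have := @Rle_Rpower n%:R 0 b; rewrite Rpower_O // => /(_ _ _)/RleP; apply.
    exact/RleP.
  by apply/RleP; apply: le_trans b4; rewrite invr_ge0.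
have xz : x ^+ 2 * z ^+ 2 = n%:R.
  rewrite -exprMn -RmultE -Rpower_plus -RpowE -Rpower_pow; last exact: exp_pos.
  rewrite Rpower_mult RmultE RplusE INRE.
  rewrite (_ : (b + t) * 2%:R = 1) ?Rpower_1 // /t; lra.
have xa : Rpower (INR n) a <= x.
  by rewrite INRE; apply/RleP/Rle_Rpower; apply/RleP.
have nK : n%:R ^+ 2 <= z ^+ K.
  rewrite -!RpowE -!Rpower_pow //; last exact: exp_pos.
  rewrite Rpower_mult RmultE; apply/RleP/Rle_Rpower; first exact/RleP.
  by apply/RleP; rewrite !INRE.
have zl : 80 * l ^+ 2 <= z by lra.
have lower := dla_prob_lower_bound x1 z1 xz xa zl nK; rewrite -/l in lower.
have upper := dla_prob_le1 (top_levels_unique n a).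
have small : 112 * l / z < e.
  rewrite ltr_pdivrMr; last by lra.
  have : 113 * l <= z * e by rewrite -ler_pdivrMr // -mulrA; lra.
  by lra.
rewrite /R_dist; apply/RltP; rewrite RabsE RminusE (_ : R1 = 1%R) //.
by rewrite ler0_norm; lra.
Qed.

Close Scope ring_scope.
Delimit Scope R_scope with R.

Theorem theorem5 (a : R) (ha : (a < / 2)%R) :
  Un_cv (fun n : nat => dla_prob (top_levels_unique n a)) R1.
Proof. by apply: dla_prob_cvg; apply/RltP. Qed.
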